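(* Let $\mathbf A$ be a finite idempotent minimal Taylor algebra and let $B\subseteq A$ be an absorbing set of $\mathbf A$ (i.e., $n$-absorbing for some $n$). Then $B$ is a subuniverse of $\mathbf A$.
   Context: $B\subseteq A$ is $n$-absorbing in $\mathbf A$ if there is an $n$-ary term operation $t$ of $\mathbf A$ such that $t(\mathbf a)\in B$ whenever $\mathbf a\in A^n$ and $|\{i: a_i\in B\}|\ge n-1$. $\mathbf A$ is Taylor if no quotient of a subalgebra of a finite power of $\mathbf A$ is a two-element algebra all of whose operations are projections; minimal Taylor if it is Taylor and no reduct with strictly smaller clone of term operations is Taylor. *)

(* Defs.v *)
From HB Require Import structures.
From mathcomp Require Import all_boot.
From mathcomp Require Import generic_quotient.

Set Implicit Arguments.
Unset Strict Implicit.
Unset Printing Implicit Defensive.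

Local Open Scope quotient_scope.

Definition operation (n : nat) (T : finType) := {ffun {ffun 'I_n -> T} -> T}.

Definition is_projection (n : nat) (T : finType) (g : operation n T) : Prop :=
  exists j : 'I_n, forall a : {ffun 'I_n -> T}, g a = a j.

(* Nullary symbols are allowed. The projections in a clone are those of
   positive arity, so a clone contains a nullary operation only if the
   signature has a nullary symbol. *)
Record signature := Signature { symbol :> Type; arity : symbol -> nat }.

Definition algebra (S : signature) (T : finType) :=
  forall f : S, operation (arity f) T.

Inductive term (S : signature) (n : nat) : Type :=
| Var of 'I_n
| App (f : S) of 'I_(arity f) -> term S n.

Fixpoint eval (S : signature) (T : finType) (A : algebra S T) (n : nat)
    (t : term S n) (a : {ffun 'I_n -> T}) : T :=
  match t with
  | Var i => a i
  | App f ts => A f [ffun i => eval A (ts i) a]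
  end.

Definition term_operation (S : signature) (T : finType) (A : algebra S T)
    (n : nat) (g : operation n T) : Prop :=
  exists t : term S n, forall a : {ffun 'I_n -> T}, g a = eval A t a.

Definition clone_sub (S S' : signature) (T : finType)
    (A : algebra S T) (A' : algebra S' T) : Prop :=
  forall (n : nat) (g : operation n T),
    term_operation A g -> term_operation A' g.

Definition idempotent_algebra (S : signature) (T : finType)
    (A : algebra S T) : Prop :=
  forall (f : S) (x : T), A f [ffun => x] = x.

(* The empty set is a subuniverse when there are no nullary symbols. *)
Definition subuniverse (S : signature) (T : finType) (A : algebra S T)
    (B : {set T}) : Prop :=
  forall (f : S) (a : {ffun 'I_(arity f) -> T}),
    (forall i, a i \in B) -> A f a \in B.

Definition power_algebra (S : signature) (T : finType) (A : algebra S T)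
    (k : nat) : algebra S {ffun 'I_k -> T} :=
  fun f => [ffun a : {ffun 'I_(arity f) -> {ffun 'I_k -> T}} =>
              [ffun j : 'I_k => A f [ffun i => a i j]]].

Lemma subuniverse_val (S : signature) (T : finType) (A : algebra S T)
    (B : {set T}) (hB : subuniverse A B) (f : S)
    (a : {ffun 'I_(arity f) -> {x : T | x \in B}}) :
  A f [ffun i => val (a i)] \in B.
Proof. by apply: hB => i; rewrite ffunE; apply: valP. Qed.

Definition subalgebra (S : signature) (T : finType) (A : algebra S T)
    (B : {set T}) (hB : subuniverse A B) : algebra S {x : T | x \in B} :=
  fun f => [ffun a : {ffun 'I_(arity f) -> {x : T | x \in B}} =>
              exist _ (A f [ffun i => val (a i)])
                      (subuniverse_val hB a)].

Definition congruence (S : signature) (T : finType) (A : algebra S T)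
    (e : equiv_rel T) : Prop :=
  forall (f : S) (a b : {ffun 'I_(arity f) -> T}),
    (forall i, e (a i) (b i)) -> e (A f a) (A f b).

(* Needed to count classes: the library stops at countable quotients. *)
HB.instance Definition _ (D : Type) (C : finType) (CD : C -> D) (DC : D -> C)
    (eD : equiv_rel D) (encD : encModRel CD DC eD) :=
  Finite.copy {eq_quot encD} (can_type (@EquivQuot.ereprK _ _ _ _ _ encD)).

(* Computed on representatives; when e is a congruence of A, this is the
   operation [a_1], ..., [a_n] |-> [f(a_1, ..., a_n)]. *)
Definition quotient_algebra (S : signature) (T : finType) (A : algebra S T)
    (e : equiv_rel T) : algebra S ({eq_quot e}) :=
  fun f => [ffun a : {ffun 'I_(arity f) -> {eq_quot e}} =>
              \pi_({eq_quot e}) (A f [ffun i => repr (a i)])].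

Definition taylor (S : signature) (T : finType) (A : algebra S T) : Prop :=
  ~ exists (k : nat) (B : {set {ffun 'I_k -> T}})
      (hB : subuniverse (power_algebra A k) B)
      (e : equiv_rel {x : {ffun 'I_k -> T} | x \in B}),
      [/\ congruence (subalgebra hB) e,
          #|{: {eq_quot e}}| = 2
        & forall f : S, is_projection (quotient_algebra (subalgebra hB) e f)].

(* The signature of a reduct is unrelated to that of the algebra: its basic
   operations are arbitrary term operations. *)
Definition reduct (S' S : signature) (T : finType)
    (A' : algebra S' T) (A : algebra S T) : Prop :=
  forall f : S', term_operation A (A' f).

Definition minimal_taylor (S : signature) (T : finType)
    (A : algebra S T) : Prop :=
  taylor A /\
  forall (S' : signature) (A' : algebra S' T),
    reduct A' A -> clone_sub A' A -> ~ clone_sub A A' -> ~ taylor A'.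

Definition n_absorbing (S : signature) (T : finType) (A : algebra S T)
    (n : nat) (B : {set T}) : Prop :=
  exists2 t : operation n T, term_operation A t &
    forall a : {ffun 'I_n -> T},
      n - 1 <= #|[set i | a i \in B]| -> t a \in B.

Definition absorbing (S : signature) (T : finType) (A : algebra S T)
    (B : {set T}) : Prop :=
  exists n : nat, n_absorbing A n B.

(* Main.v *)
(** Suppose the term operation t witnesses that B is absorbing, and let C be the
    clone of all term operations preserving B. It contains t, and also every
    t(y_1, ..., g(x), ..., y_n) with g an arbitrary term operation. Choosing g
    to satisfy the Taylor identities shows that C cannot act by projections on
    a two-element quotient, so C is Taylor; by minimality C is the whole clone.

    The Taylor identities come from the classical argument: if every term
    operation g has a coordinate that can be read off from the binary minors of
    g, then composing enough operations gives a map from the free algebra on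
    two generators onto {0, 1} under which every symbol becomes a
    projection. *)

Require Import Defs.
From mathcomp Require Import all_boot.
From mathcomp Require Import generic_quotient boolp.

Set Implicit Arguments.
Unset Strict Implicit.
Unset Printing Implicit Defensive.

Local Open Scope quotient_scope.

(** * Clones with variables indexed by arbitrary types *)

Section Clone.
Variables (S : signature) (T : finType) (A : algebra S T).

(** Variables may come from any type, so composites can be indexed by products and sums without
    recoding into ordinals. *)
Inductive clone (X : Type) : ((X -> T) -> T) -> Prop :=
| clone_proj (x : X) : clone (fun a => a x)
| clone_app (f : S) (gs : 'I_(arity f) -> (X -> T) -> T) :
    (forall i, clone (gs i)) -> clone (fun a => A f [ffun i => gs i a]).

Lemma clone_comp (X Y : Type) (g : (X -> T) -> T) (hs : X -> (Y -> T) -> T) :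
  clone g -> (forall x, clone (hs x)) -> clone (fun a => g (fun x => hs x a)).
Proof.
move=> gC hsC; elim: gC => [x|f gs _ IH]; first exact: hsC.
exact: (clone_app (gs := fun i a => gs i (fun x => hs x a)) IH).
Qed.

Lemma clone_rename (X Y : Type) (g : (X -> T) -> T) (r : X -> Y) :
  clone g -> clone (fun a => g (a \o r)).
Proof. by move=> gC; apply: (clone_comp gC) => x; apply: clone_proj. Qed.

Lemma clone_symbol (f : S) : clone (fun a => A f (finfun a)).
Proof. exact: (clone_app (gs := fun i a => a i) (@clone_proj _)). Qed.

Lemma term_operation_clone (n : nat) (g : operation n T) :
  term_operation A g <-> clone (fun a => g (finfun a)).
Proof.
split=> [[t gt]|].
  have -> : (fun a => g (finfun a)) = (fun a => eval A t (finfun a)).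
    by apply: funext => a; rewrite gt.
  elim: t {g gt} => [i|f ts IH] /=; last exact: clone_app.
  have -> : (fun a : 'I_n -> T => (finfun a) i) = (fun a => a i).
    by apply: funext => a; rewrite ffunE.
  exact: clone_proj.
set h := (fun a => _) => hC.
suff [t ht] : exists t : term S n, forall a, h a = eval A t (finfun a).
  exists t => a; have := ht a; rewrite /h.
  by have -> : finfun a = a by apply/ffunP => i; rewrite ffunE.
elim: {g} h / hC => [i|f gs _ IH]; first by exists (Var S i) => a; rewrite /= ffunE.
have [ts tsP] := fin_all_exists IH.
by exists (App ts) => a /=; congr (A f _); apply/ffunP => i; rewrite !ffunE.
Qed.

Lemma clone_preserves (X : Type) (g : (X -> T) -> T) (B : {set T}) (a : X -> T) :
  subuniverse A B -> clone g -> (forall x, a x \in B) -> g a \in B.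
Proof.
move=> AB gC aB; elim: gC => [x|f gs _ IH]; first exact: aB.
by apply: AB => i; rewrite ffunE.
Qed.

Lemma clone_idempotent (X : Type) (g : (X -> T) -> T) (c : T) :
  idempotent_algebra A -> clone g -> g (fun=> c) = c.
Proof.
move=> idA; elim=> [//|f gs _ IH]; rewrite -[RHS](idA f).
by congr (A f _); apply/ffunP => i; rewrite !ffunE.
Qed.

(** * Star composition and binary minors *)

Definition star (X Y : Type) (g : (X -> T) -> T) (h : (Y -> T) -> T)
    (a : X * Y -> T) : T :=
  g (fun x => h (fun y => a (x, y))).

Lemma clone_star (X Y : Type) (g : (X -> T) -> T) (h : (Y -> T) -> T) :
  clone g -> clone h -> clone (star g h).
Proof.
by move=> gC hC; apply: (clone_comp gC) => x; apply: (clone_rename (pair x)).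
Qed.

(* Binary operations are tabulated as elements of T^k with k = #|T^2|, so that
   the free algebra on two generators is a subalgebra of a finite power. *)
Local Notation pairs := #|{: {ffun bool -> T}}|.

Definition minor (X : Type) (g : (X -> T) -> T) (u : X -> bool) :
    {ffun 'I_pairs -> T} :=
  [ffun j => g (fun x => (enum_val j : {ffun bool -> T}) (u x))].

Lemma minor_eq (X : Type) (g : (X -> T) -> T) (u v : X -> bool) (c : bool -> T) :
  minor g u = minor g v -> g (c \o u) = g (c \o v).
Proof.
move/ffunP/(_ (enum_rank (finfun c))); rewrite !ffunE enum_rankK.
have cE w : (fun x : X => finfun c (w x)) = c \o w.
  by apply: funext => x; rewrite ffunE.
by rewrite !cE.
Qed.

(** Each copy of [g] may have its variables merged in its own way, so [f] applied to arbitrary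
    minors of [g] is a single minor of the star. *)
Lemma minor_star_symbol (X : Type) (f : S) (u : 'I_(arity f) -> X -> bool)
    (g : (X -> T) -> T) :
  minor (star (fun a => A f (finfun a)) g) (fun p => u p.1 p.2) =
  power_algebra A pairs f [ffun l => minor g (u l)].
Proof.
apply/ffunP => j; rewrite !ffunE; congr (A f _).
by apply/ffunP => l; rewrite !ffunE.
Qed.

(** All copies of [h] get the same arguments, so [g] sees a constant tuple and idempotence removes
    it. *)
Lemma minor_star_r (X Y : Type) (g : (X -> T) -> T) (h : (Y -> T) -> T)
    (u : Y -> bool) :
  idempotent_algebra A -> clone g ->
  minor (star g h) (u \o snd) = minor h u.
Proof.
by move=> idA gC; apply/ffunP => j; rewrite !ffunE /star /= clone_idempotent.
Qed.

Lemma minor_star_l (X Y : Type) (g : (X -> T) -> T) (h : (Y -> T) -> T)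
    (u : X -> bool) :
  idempotent_algebra A -> clone h ->
  minor (star g h) (u \o fst) = minor g u.
Proof.
move=> idA hC; apply/ffunP => j; rewrite !ffunE /star /=.
by congr g; apply: funext => x; rewrite clone_idempotent.
Qed.

Definition free2 : {set {ffun 'I_pairs -> T}} :=
  [set h | `[< exists2 g, clone g & h = minor g (@id bool) >]].

Lemma free2P (h : {ffun 'I_pairs -> T}) :
  reflect (exists2 g, clone g & h = minor g (@id bool)) (h \in free2).
Proof. by rewrite inE; apply: asboolP. Qed.

Lemma minor_free2 (X : Type) (g : (X -> T) -> T) (u : X -> bool) :
  clone g -> minor g u \in free2.
Proof.
move=> gC; apply/free2P; exists (fun a => g (a \o u)) => //.
exact: clone_rename.
Qed.

Lemma subuniverse_free2 : subuniverse (power_algebra A pairs) free2.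
Proof.
move=> f a aF.
have /fin_all_exists[gs gsP] i : exists g, clone g /\ a i = minor g (@id bool).
  by have /free2P[g gC ->] := aF i; exists g.
apply/free2P; exists (fun c => A f [ffun i => gs i c]).
  by apply: clone_app => i; case: (gsP i).
apply/ffunP => j; rewrite !ffunE; congr (A f _); apply/ffunP => i.
by rewrite !ffunE (gsP i).2 ffunE.
Qed.

(** * Taylor operations and two-valued maps on the free algebra *)

Definition separating (X : Type) (g : (X -> T) -> T) (i : X) : Prop :=
  forall u v, minor g u = minor g v -> u i = v i.

(** Failure of separation at [i] gives [u] and [v] that differ at [i] but have equal minors: a
    two-variable Taylor identity for coordinate [i]. *)
Definition taylor_operation (X : Type) (g : (X -> T) -> T) : Prop :=
  clone g /\ forall i, ~ separating g i.

Definition universal (X : Type) (g : (X -> T) -> T) : Prop :=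
  clone g /\ forall h, h \in free2 -> exists u, h = minor g u.

(** On [free2] this is a homomorphism onto a two-element algebra of projections. Taking [phi] on the
    whole finite power lets the candidates be enumerated. *)
Definition character (phi : {ffun {ffun 'I_pairs -> T} -> bool}) : Prop :=
  (forall b, phi (minor (fun a : unit -> T => a tt) (fun=> b)) = b) /\
  forall f : S, exists k, forall hs : {ffun 'I_(arity f) -> _},
    (forall l, hs l \in free2) -> phi (power_algebra A pairs f hs) = phi (hs k).

Definition induces (X : Type) (g : (X -> T) -> T) (i : X)
    (phi : {ffun {ffun 'I_pairs -> T} -> bool}) : Prop :=
  forall u, phi (minor g u) = u i.

Hypothesis idA : idempotent_algebra A.

(** Star together one operation per element of the free algebra: by idempotence the minors of each
    factor survive in the star. *)
Lemma exists_universal :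
  exists (X : finType) (g : (X -> T) -> T), universal g.
Proof.
suff [X [g [gC gU]]] : exists (X : finType) (g : (X -> T) -> T),
    clone g /\ forall h, h \in enum free2 -> exists u, h = minor g u.
  by exists X, g; split=> // h hF; apply: gU; rewrite mem_enum.
have : {subset enum free2 <= free2} by move=> h; rewrite mem_enum.
elim: (enum _) => [_|h s IH sF].
  by exists unit, (fun a => a tt); split; first exact: clone_proj.
have [|X [g [gC gU]]] := IH; first by move=> h' h's; apply: sF; rewrite inE h's orbT.
have /free2P[g0 g0C ->] : h \in free2 by apply: sF; rewrite mem_head.
exists (bool * X)%type, (star g0 g); split; first exact: clone_star.
move=> h'; rewrite inE => /orP[/eqP->|/gU[u ->]].
  by exists (id \o fst); rewrite minor_star_l.
by exists (u \o snd); rewrite minor_star_r.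
Qed.

Lemma universal_star (X : Type) (f : S) (g : (X -> T) -> T) :
  universal g -> universal (star (fun a => A f (finfun a)) g).
Proof.
move=> [gC gU]; split; first exact: (clone_star (clone_symbol f)).
move=> h /gU[u ->]; exists (u \o snd).
by rewrite (minor_star_r _ _ idA (clone_symbol f)).
Qed.

Lemma induces_star (X : Type) (f : S) (g : (X -> T) -> T) k i phi :
  induces (star (fun a => A f (finfun a)) g) (k, i) phi -> induces g i phi.
Proof.
by move=> ind u; rewrite -(minor_star_r g u idA (clone_symbol f)) ind.
Qed.

(** By universality the arguments [hs] are minors of [g] along some [u l]; merging the [l]-th copy
    along [u l], coordinate [(k, i)] of the star reads [u k i]. *)
Lemma induces_star_proj (X : Type) (f : S) (g : (X -> T) -> T) k i phi
    (hs : {ffun 'I_(arity f) -> _}) :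
  universal g -> induces (star (fun a => A f (finfun a)) g) (k, i) phi ->
  (forall l, hs l \in free2) -> phi (power_algebra A pairs f hs) = phi (hs k).
Proof.
move=> [_ gU] ind hsF.
have /fin_all_exists[u hsE] l : exists u, hs l = minor g u by apply: gU.
have {1}-> : hs = [ffun l => minor g (u l)].
  by apply/ffunP => l; rewrite ffunE.
by rewrite -minor_star_symbol ind hsE (induces_star ind).
Qed.

(** Separation makes [u i] depend on the minor alone, so it can serve as the value of [phi]
    there. *)
Lemma separating_induces (X : Type) (g : (X -> T) -> T) (i : X) :
  separating g i -> exists phi, induces g i phi.
Proof.
move=> gi; exists [ffun h => `[< exists2 u, h = minor g u & u i >]] => u.
rewrite ffunE; apply/asboolP/idP => [[v uv vi]|ui]; last by exists u.
by rewrite (gi _ _ uv).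
Qed.

(* Composing with a symbol f discards every induced phi that f violates, and
   there are only finitely many maps phi. *)
Lemma exists_character :
  (forall (X : finType) (g : (X -> T) -> T), ~ taylor_operation g) ->
  exists phi, character phi.
Proof.
move=> noT; apply: contrapT => noC.
suff [X [g [gU no_ind]]] : exists (X : finType) (g : (X -> T) -> T),
    universal g /\ forall phi, phi \in enum {: {ffun {ffun 'I_pairs -> T} -> bool}} ->
      forall i, ~ induces g i phi.
  apply: (noT X g); split=> [|i gi]; first by case: gU.
  have [phi] := separating_induces gi.
  by apply: no_ind; rewrite mem_enum.
elim: (enum _) => [|phi s [X [g [gU IH]]]].
  by have [X [g gU]] := exists_universal; exists X, g.
(* If [phi] is wrong on a generator, the current [g] already excludes it: by idempotence, merging
   all variables of [g] gives that generator. *)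
have [[b phib]|/forallNP unit_phi] := pselect (exists b,
    phi (minor (fun a : unit -> T => a tt) (fun=> b)) <> b).
  exists X, g; split=> // phi'; rewrite inE => /orP[/eqP-> i ind|]; last exact: IH.
  apply: phib; rewrite -[RHS](ind (fun=> b)); congr (phi _).
  apply/ffunP => j; rewrite !ffunE clone_idempotent //; by case: gU.
have /existsNP[f noproj] : ~ forall f : S, exists k,
    forall hs : {ffun 'I_(arity f) -> _},
    (forall l, hs l \in free2) -> phi (power_algebra A pairs f hs) = phi (hs k).
  by move=> proj; apply: noC; exists phi; split=> // b; apply: contrapT.
exists ('I_(arity f) * X)%type, (star (fun a => A f (finfun a)) g).
split; first exact: universal_star.
move=> phi'; rewrite inE => /orP[/eqP->|phi's] [k i] ind.
  by apply: noproj; exists k => hs; apply: (induces_star_proj gU ind).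
exact: IH phi's i (induces_star ind).
Qed.

Lemma character_not_taylor phi : character phi -> ~ taylor A.
Proof.
move=> [phi_unit phi_proj]; apply.
exists pairs, free2, subuniverse_free2.
have phi_sub f : exists k, forall a : {ffun 'I_(arity f) -> {x | x \in free2}},
    phi (val (subalgebra subuniverse_free2 f a)) = phi (val (a k)).
  have [k phik] := phi_proj f; exists k => a.
  have aF l : [ffun m => val (a m)] l \in free2 by rewrite ffunE; apply: valP.
  by rewrite /subalgebra ffunE (phik _ aF) ffunE.
(* The kernel of [phi]; its two classes are those of the generators. *)
pose r (d d' : {x | x \in free2}) := phi (val d) == phi (val d').
have r_refl : reflexive r by move=> d; apply: eqxx.
have r_sym : symmetric r by move=> d d'; apply: eq_sym.
have r_trans : transitive r by move=> d d' d'' /eqP rd; rewrite /r rd.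
pose e := EquivRel r r_refl r_sym r_trans.
exists e; split=> [f a b ab| |f].
- have [k phik] := phi_sub f; rewrite /= /r !phik; exact: ab.
- pose dp b : {x | x \in free2} :=
    exist (fun x => x \in free2) _ (minor_free2 (fun=> b) (clone_proj tt)).
  pose chi (q : {eq_quot e}) : bool := phi (val (repr q)).
  have chi_pi d : chi (\pi d) = phi (val d).
    have : \pi_({eq_quot e}) (repr (\pi_({eq_quot e}) d)) = \pi d by rewrite reprK.
    by move/eqmodP => /= /eqP.
  rewrite -card_bool; apply: (@bij_eq_card _ _ chi).
  exists (fun b => \pi_({eq_quot e}) (dp b)) => [q|b]; last by rewrite chi_pi phi_unit.
  rewrite -[RHS]reprK; apply/eqmodP/eqP => /=; exact: phi_unit.
- have [k phik] := phi_sub f; exists k => a.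
  rewrite ffunE -[RHS]reprK; apply/eqmodP/eqP.
  by rewrite phik ffunE.
Qed.

Theorem exists_taylor_operation :
  taylor A -> exists (X : finType) (g : (X -> T) -> T), taylor_operation g.
Proof.
move=> TA; apply: contrapT => noT.
have [|phi /character_not_taylor] := exists_character; last exact.
by move=> X g gT; apply: noT; exists X, g.
Qed.

End Clone.

Lemma quotient_projection (S : signature) (T : finType) (A : algebra S T)
    (e : equiv_rel T) (f : S) :
  congruence A e -> is_projection (quotient_algebra A e f) ->
  exists i, forall a : {ffun 'I_(arity f) -> T}, e (A f a) (a i).
Proof.
move=> eC [i fi]; exists i => a.
have /eqmodP ei :
    A f [ffun l => repr ([ffun m => \pi_({eq_quot e}) (a m)] l)] = a i
      %[mod {eq_quot e}].
  by have := fi [ffun m => \pi_({eq_quot e}) (a m)]; rewrite !ffunE.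
apply: equiv_trans ei; apply: eC => l.
by rewrite !ffunE; apply/eqmodP; rewrite reprK.
Qed.

(** * The reduct of all term operations preserving [B] *)

Section Stabilizer.
Variables (S : signature) (T : finType) (A : algebra S T) (B : {set T}).

Definition preserving (X : Type) (g : (X -> T) -> T) : Prop :=
  forall a, (forall x, a x \in B) -> g a \in B.

Definition stabilizer_signature : signature :=
  @Signature {n : nat & {g : operation n T |
    term_operation A g /\ preserving (fun a => g (finfun a))}} (@tag _ _).

Definition stabilizer : algebra stabilizer_signature T :=
  fun f => sval (tagged f).

Lemma reduct_stabilizer : reduct stabilizer A.
Proof. by case=> n [g []]. Qed.

Lemma clone_sub_reduct (S' : signature) (A' : algebra S' T) :
  reduct A' A -> clone_sub A' A.
Proof.
move=> A'A n g /term_operation_clone gC; apply/term_operation_clone.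
elim: gC => [x|f gs _ IH]; first exact: clone_proj.
have /term_operation_clone fC := A'A f.
exact: (clone_comp fC IH).
Qed.

Lemma subuniverse_stabilizer : subuniverse stabilizer B.
Proof.
case=> n [g [gC gB]] a aB; rewrite /stabilizer /=.
by have := gB a aB; congr (g _ \in B); apply/ffunP => i; rewrite ffunE.
Qed.

Lemma clone_sub_subuniverse : clone_sub A stabilizer -> subuniverse A B.
Proof.
move=> AB f a aB.
have /AB/term_operation_clone fC : term_operation A (A f).
  exact/term_operation_clone/clone_symbol.
have := clone_preserves subuniverse_stabilizer fC aB.
by congr (A f _ \in B); apply/ffunP => i; rewrite ffunE.
Qed.

Hypothesis idA : idempotent_algebra A.

Section ProjectionQuotient.
Variables (k : nat) (D : {set {ffun 'I_k -> T}}).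
Variables (hD : subuniverse (power_algebra stabilizer k) D).
Variable e : equiv_rel {x : {ffun 'I_k -> T} | x \in D}.
Hypothesis eC : congruence (subalgebra hD) e.
Hypothesis eP : forall f, is_projection (quotient_algebra (subalgebra hD) e f).

(** Once its variables are numbered, [g] is itself a basic operation of the stabilizer, so [eP]
    applies to it directly; [c] is its value in [D]. *)
Lemma projection_on_quotient (X : finType) (g : (X -> T) -> T) :
  clone A g -> preserving g ->
  exists x, forall d : X -> {x | x \in D}, exists2 c : {x | x \in D},
    (forall j, val c j = g (fun x => val (d x) j)) & e c (d x).
Proof.
move=> gC gB.
pose h : operation #|X| T :=
  [ffun a : {ffun 'I_#|X| -> T} => g (a \o enum_rank)].
have hE (a : 'I_#|X| -> T) : h (finfun a) = g (a \o enum_rank).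
  by rewrite ffunE; congr g; apply: funext => x; rewrite /= ffunE.
have hC : term_operation A h.
  apply/term_operation_clone.
  have -> : (fun a => h (finfun a)) = (fun a => g (a \o enum_rank)).
    exact: funext.
  exact: clone_rename.
have hB : preserving (fun a => h (finfun a)).
  by move=> a aB; rewrite hE; apply: gB => x; apply: aB.
pose f : stabilizer_signature := Tagged _ (exist _ h (conj hC hB)).
have [i fi] := quotient_projection eC (eP f); exists (enum_val i) => d.
pose a : {ffun 'I_#|X| -> {x | x \in D}} := [ffun l => d (enum_val l)].
exists (subalgebra hD f a) => [j|].
  rewrite /subalgebra !ffunE /= !ffunE /=.
  by congr g; apply: funext => x; rewrite /= !ffunE enum_rankK.
by have := fi a; rewrite [a i]ffunE.
Qed.
End ProjectionQuotient.

(* On a two-element quotient on which the stabilizer acts by projections, t is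
   a projection onto some coordinate i. Replacing that argument by g(x), for a
   Taylor operation g, keeps an operation preserving B: its value cannot
   depend on x because g is Taylor, and it cannot depend on another argument
   of t because g is idempotent. *)
Lemma taylor_stabilizer (n : nat) :
  taylor A -> n_absorbing A n B -> taylor stabilizer.
Proof.
move=> /(exists_taylor_operation idA)[X [g [gC gT]]] [t tC tB].
case=> k [D [hD [e [eC card2 eP]]]].
have [q0 [q1 q01]] : exists q0 q1 : {eq_quot e}, q0 != q1.
  have /card_gt1P[q0 [q1 [_ _ ?]]] : 1 < #|{: {eq_quot e}}| by rewrite card2.
  by exists q0, q1.
pose c (b : bool) := repr (if b then q1 else q0).
have cI b b' : e (c b) (c b') -> b = b'.
  move/eqmodP; rewrite !reprK; case: b; case: b' => // /eqP.
    by rewrite eq_sym (negPf q01).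
  by rewrite (negPf q01).
have /term_operation_clone tC' := tC.
have [|i ti] := projection_on_quotient eC eP tC'.
  move=> a aB; apply: tB; rewrite (_ : [set _ | _] = setT) ?cardsT ?card_ord ?leq_subr //.
  by apply/setP => l; rewrite !inE ffunE aB.
pose s (a : 'I_n + X -> T) :=
  t [ffun l => if l == i then g (a \o inr) else a (inl l)].
have sC : clone A s.
  have := clone_comp (Y := ('I_n + X)%type) tC' (hs := fun l a =>
            if l == i then g (a \o inr) else a (inl l)); apply.
  by move=> l; case: eqP => _; [apply: clone_rename | apply: clone_proj].
(* Only argument [i] of [t] can leave [B]; the other [n - 1] stay inside, which is what absorption
   requires. *)
have sB : preserving s.
  move=> a aB; apply: tB.
  have : #|[set~ i]| = n - 1 by rewrite cardsC1 card_ord subn1.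
  move=> <-; apply: subset_leq_card; apply/subsetP => l.
  by rewrite !inE ffunE => /negPf->.
have [[l|x] sx] := projection_on_quotient eC eP sC sB.
(* Put [c true] on the variables of [t] and [c false] on those of [g]: as [g] is idempotent, [s] and
   [t] compute the same element, which [t] places in the class of [c false] and [s] in that of
   [c true]. *)
- have [d dE de] := ti (fun m => c (m != i)).
  pose a (y : 'I_n + X) := if y is inl _ then true else false.
  have [d' d'E d'e] := sx (c \o a).
  have dd' : d' = d.
    apply/val_inj/ffunP => j; rewrite d'E dE; congr (t _).
    apply/ffunP => m; rewrite !ffunE; case: eqP => _ //=.
    exact: (clone_idempotent (val (c false) j) idA gC).
  rewrite eqxx /= in de; rewrite dd' equiv_sym /= in d'e.
  by have := cI _ _ (equiv_trans d'e de).
(* If [s] projects onto a variable [x] of [g], equal minors along [u] and [v] give equal values of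
   [s], hence [u x = v x], making [x] separating. *)
- apply: (gT x) => u v uv.
  pose a w (y : 'I_n + X) := if y is inr y' then w y' else true.
  have [d dE de] := sx (c \o a u).
  have [d' d'E d'e] := sx (c \o a v).
  have dd' : d' = d.
    apply/val_inj/ffunP => j; rewrite d'E dE; congr (t _).
    apply/ffunP => m; rewrite !ffunE; case: eqP => _ //=.
    exact: esym (minor_eq (fun b => val (c b) j) uv).
  rewrite dd' in d'e; rewrite equiv_sym in de.
  exact: (cI _ _ (equiv_trans de d'e)).
Qed.
End Stabilizer.

Theorem mainTheorem12 (S : signature) (T : finType) (A : algebra S T)
    (B : {set T}) :
  idempotent_algebra A -> minimal_taylor A -> absorbing A B ->
  subuniverse A B.
Proof.
move=> idA [TA minA] [n nB]; apply: contrapT => notB.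
apply: (minA _ _ (@reduct_stabilizer _ _ A B)).
- exact: clone_sub_reduct (@reduct_stabilizer _ _ A B).
- by move=> /clone_sub_subuniverse.
- exact: taylor_stabilizer nB.
Qed.
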